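(* Let $(X,X^+)$ be an ordered Banach space with a generating cone $X^+$. For every nonlinear operator $A:X^+\to X^+$, the following conditions are equivalent: (i) $\mathrm{id}-A$ satisfies the MBI property. (ii) The uniform small-gain condition holds: there exists $\eta\in\mathcal{K}_\infty$ such that $\mathrm{dist}(A(x)-x,X^+)\ge\eta(\|x\|_X)$ for all $x\in X^+$.
   Context: An ordered Banach space $(X,X^+)$ is a real Banach space $X$ with a closed subset $X^+$ (cone) satisfying $X^+\cap(-X^+)=\{0\}$, $\mathbb{R}_+\cdot X^+\subset X^+$, $X^++X^+\subset X^+$; the order is $x\le y$ iff $y-x\in X^+$. The cone is generating if $X^+-X^+=X$. ''Nonlinear operator'' means an arbitrary (not necessarily linear) map. $\mathcal{K}_\infty$ is the set of continuous, strictly increasing, unbounded $\gamma:\mathbb{R}_+\to\mathbb{R}_+$ with $\gamma(0)=0$. $\mathrm{dist}(x,S)=\inf_{y\in S}\|x-y\|_X$. $\mathrm{id}-A$ has the monotone bounded invertibility (MBI) property if there is $\xi\in\mathcal{K}_\infty$ such that for all $v,w\in X^+$: $(\mathrm{id}-A)(v)\le w$ implies $\|v\|_X\le\xi(\|w\|_X)$. *)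

(* Defs.v *)
From HB Require Import structures.
From mathcomp Require Import all_boot all_order all_algebra.
From mathcomp Require Import all_classical all_reals all_analysis.

Set Implicit Arguments.
Unset Strict Implicit.
Unset Printing Implicit Defensive.

Import Order.TTheory GRing.Theory Num.Theory.
Import numFieldNormedType.Exports.

Local Open Scope classical_set_scope.
Local Open Scope ring_scope.

Definition Rplus (R : realType) : set R := [set x | 0 <= x].
Arguments Rplus R : clear implicits.

(** Comparison functions are maps on [0, +oo[; here they are total functions
    on R of which only the restriction to [Rplus R] is constrained. *)
Definition class_Kinfty (R : realType) (g : R -> R) : Prop :=
  [/\ set_fun (Rplus R) (Rplus R) g,
      {within Rplus R, continuous g},
      (forall s t, Rplus R s -> Rplus R t -> s < t -> g s < g t),
      ~ has_ubound (g @` Rplus R) &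
      g 0 = 0].

Section OrderedBanach.
Context {R : realType} {X : completeNormedModType R}.
Implicit Types (C S : set X) (T A : X -> X).

(** [(X, C)] is an ordered Banach space. *)
Definition ordered_banach_cone C : Prop :=
  [/\ closed C,
      C `&` [set - x | x in C] = [set 0],
      (forall (a : R) (x : X), 0 <= a -> C x -> C (a *: x)) &
      (forall x y : X, C x -> C y -> C (x + y))].

Definition generating C : Prop := [set x - y | x in C & y in C] = [set: X].

Definition cone_le C (x y : X) : Prop := C (y - x).

Definition dist (x : X) S : R := inf [set `|x - y| | y in S].

Definition MBI C T : Prop :=
  exists2 xi : R -> R, class_Kinfty xi &
    forall v w : X, C v -> C w -> cone_le C (T v) w -> `|v| <= xi `|w|.

Definition uniform_small_gain C A : Prop :=
  exists2 eta : R -> R, class_Kinfty eta &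
    forall x : X, C x -> dist (A x - x) C >= eta `|x|.

End OrderedBanach.

(* Main.v *)
(** A generating closed cone in a Banach space admits bounded decompositions
    [x = a - b] with [a, b] in the cone and [|a|, |b| <= K |x|] (Krein-Smulian);
    as for the open mapping theorem, Baire's theorem gives approximate bounded
    decompositions, and iterating on the remainder makes them exact.
    From MBI to small gain: if [p] is in the cone and
    [A x - x - p = a - b] is such a decomposition, then [x - A x <= b], so that
    [|x| <= xi (K |A x - x - p|)]; minimize over [p] and invert [xi].
    Conversely, if [v - A v <= w], then [p := w - v + A v] is in the cone at
    distance [|w|] of [A v - v], so that [eta |v| <= |w|]. *)
Require Import Defs.
From HB Require Import structures.
From mathcomp Require Import all_boot all_order all_algebra.
From mathcomp Require Import all_classical all_reals all_analysis.
From mathcomp Require Import ring lra.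

Import Order.TTheory GRing.Theory Num.Theory.
Import numFieldNormedType.Exports.

Local Open Scope classical_set_scope.
Local Open Scope ring_scope.

(** * Comparison functions: order, surjectivity and inverses on the half-line *)

Lemma Kinfty_ge0 {R : realType} {g : R -> R} {t : R} :
  class_Kinfty g -> 0 <= t -> 0 <= g t.
Proof. by move=> [gge0 _ _ _ _]; exact: gge0. Qed.

Lemma Kinfty_lt {R : realType} {g : R -> R} {s t : R} :
  class_Kinfty g -> 0 <= s -> 0 <= t -> (g s < g t) = (s < t).
Proof.
move=> [_ _ gmono _ _] s0 t0; apply/idP/idP => [|]; last exact: gmono.
apply: contraTT; rewrite -!leNgt le_eqVlt => /orP[/eqP->//|ts].
exact/ltW/gmono.
Qed.

Lemma Kinfty_le {R : realType} {g : R -> R} {s t : R} :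
  class_Kinfty g -> 0 <= s -> 0 <= t -> (g s <= g t) = (s <= t).
Proof. by move=> gK s0 t0; rewrite !leNgt (Kinfty_lt gK). Qed.

Lemma Kinfty_surj {R : realType} {g : R -> R} {t : R} :
  class_Kinfty g -> 0 <= t -> exists2 s, 0 <= s & g s = t.
Proof.
move=> gK t0; have [gge0 gcont gmono gunb g0] := gK.
have [s s0 ts] : exists2 s, 0 <= s & t <= g s.
  apply: contrapT => nex; apply: gunb; exists t => _ [s s0 <-].
  by rewrite leNgt; apply/negP => /ltW ts; apply: nex; exists s.
have [||c cs <-] := @IVT R g 0 s t s0.
- apply: continuous_subspaceW gcont => x /=.
  by rewrite in_itv /= => /andP[].
- by rewrite g0 ge_min le_max t0 ts orbT.
by exists c => //; move: cs; rewrite in_itv /= => /andP[].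
Qed.

(** Surjectivity gives a right inverse by choice; strict monotonicity of [g] makes it two-sided on
    the half-line, and order statements about [h] are then read off through [g]. *)
Lemma Kinfty_inverse {R : realType} {g : R -> R} :
  class_Kinfty g ->
  exists2 h : R -> R, class_Kinfty h & forall t, 0 <= t -> g (h t) = t.
Proof.
move=> gK; have [_ _ _ _ g0] := gK.
have /choice[h hP] : forall t, exists s, 0 <= t -> 0 <= s /\ g s = t.
  move=> t; have [t0|_] := leP 0 t; last by exists 0.
  by have [s s0 gs] := Kinfty_surj gK t0; exists s.
have h_ge0 t : 0 <= t -> 0 <= h t by move=> /hP[].
have hK t : 0 <= t -> g (h t) = t by move=> /hP[].
have h_lt s t : 0 <= s -> 0 <= t -> (h s < h t) = (s < t).
  by move=> s0 t0; rewrite -(Kinfty_lt gK) ?h_ge0// !hK.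
have gKh s : 0 <= s -> h (g s) = s.
  move=> s0; have gs0 := Kinfty_ge0 gK s0.
  by apply: le_anti; apply/andP; split;
    rewrite -(Kinfty_le gK) ?h_ge0 ?hK ?lexx.
exists h => //; split.
- by move=> t; exact: h_ge0.
- apply/subspace_continuousP => t t0.
  apply/cvgrPdist_lt => e e0; rewrite near_withinE.
  have gte : t < g (h t + e).
    by rewrite -{1}(hK t)// (Kinfty_lt gK) ?ltrDl ?addr_ge0 ?h_ge0// ltW.
  have upper : \forall s \near t, 0 <= s -> h s < h t + e.
    near=> s => s0; rewrite -(Kinfty_lt gK) ?h_ge0 ?addr_ge0 ?h_ge0//.
      by rewrite hK//; near: s; exact: lt_nbhsl.
    exact: ltW.
  have lower : \forall s \near t, 0 <= s -> h t - e < h s.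
    (* Comparison through [g] is legitimate only at nonnegative points; a negative [h t - e] lies
       below [h s] by sign alone. *)
    have [he|he] := leP 0 (h t - e); last first.
      by near=> s => s0; exact: lt_le_trans he (h_ge0 _ s0).
    near=> s => s0; rewrite -(Kinfty_lt gK) ?h_ge0//.
    rewrite hK//; near: s; apply: lt_nbhsr.
    by rewrite -{2}(hK t)// (Kinfty_lt gK) ?h_ge0// ltrBlDr ltrDl.
  near=> s => s0; rewrite distrC ltr_distl.
  by apply/andP; split; move: s0; near: s.
- by move=> s t s0 t0 st; rewrite h_lt.
- move=> [M hM]; have M0 : 0 <= M.
    by apply: hM; exists 0; [exact: lexx|rewrite -{1}g0 gKh].
  have M10 : 0 <= M + 1 by rewrite addr_ge0.
  have /hM : (h @` Rplus R) (M + 1).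
    by exists (g (M + 1)); [exact: Kinfty_ge0|exact: gKh].
  by rewrite gerDl ler10.
- by rewrite -{1}g0 gKh.
Unshelve. all: by end_near. Qed.

Lemma Kinfty_div {R : realType} {g : R -> R} {M : R} :
  0 < M -> class_Kinfty g -> class_Kinfty (fun t => g t / M).
Proof.
move=> M0 gK; have [_ gcont gmono gunb g0] := gK; split.
- by move=> t t0 /=; rewrite /Rplus /= divr_ge0 ?(Kinfty_ge0 gK)// ltW.
- move/subspace_continuousP : gcont => gcont.
  apply/subspace_continuousP => t t0.
  by apply: cvgMr_tmp; exact: gcont.
- by move=> s t s0 t0 st; rewrite ltr_pM2r ?invr_gt0// gmono.
- move=> [N hN]; apply: gunb; exists (N * M) => _ [t t0 <-].
  by rewrite -ler_pdivrMr//; apply: hN; exists t.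
- by rewrite g0 mul0r.
Qed.

(** * Bounded decompositions along a generating cone *)

Section Cone.
Context {R : realType} {X : completeNormedModType R}.
Context {C : set X}.
Hypothesis hC : ordered_banach_cone C.

Let cone0 : C 0.
Proof.
have [_ h _ _] := hC; have : [set (0 : X)] 0 by [].
by rewrite -h => -[].
Qed.

Lemma dist_le {x y : X} : C y -> dist x C <= `|x - y|.
Proof. by move=> Cy; apply: ge_inf; [exists 0 => _ [z _ <-]|exists y]. Qed.

Lemma le_dist {x : X} {d : R} :
  (forall y, C y -> d <= `|x - y|) -> d <= dist x C.
Proof.
(* An infimum dominates every lower bound only if the set is nonempty; the point 0 of the cone
   ensures this. *)
move=> dP; apply: lb_le_inf; first by exists `|x - 0|; exists 0.
by move=> _ [y Cy <-]; exact: dP.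
Qed.

(** A difference of two points of a ball reaches every direction, and stability of the cone under
    sums makes it again a difference of cone elements. An error [e] remains because Baire's theorem
    only provides a ball in a closure. *)
Lemma approx_decomposition : generating C ->
  exists2 K : R, 0 < K & forall (x : X) (e : R), 0 < e -> exists a b : X,
    [/\ C a, C b, `|a| <= K * `|x|, `|b| <= K * `|x| & `|x - (a - b)| < e].
Proof.
move=> hgen; have [_ _ CZ CD] := hC.
pose E (n : nat) : set X := [set x | exists a b : X,
  [/\ C a, C b, `|a| <= n%:R, `|b| <= n%:R & x = a - b]].
have [n [x0 [r [r0 ballE]]]] : exists (n : nat) (x0 : X) (r : R),
    0 < r /\ ball x0 r `<=` closure (E n).
  have [n /denseNE[U [[x0 Ux0] UE]]] : exists n, ~ dense (~` closure (E n)).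
    (* Otherwise Baire's theorem yields a point outside all the closures; but it is some [a - b],
       hence in [E n] once [n] exceeds both norms. *)
    apply: contrapT => /forallNP nd.
    have [|//||x [_ xP]] := @Baire R X (fun n => ~` closure (E n)) _ setT.
    - by move=> n; split; [apply/closed_openC/closed_closure|apply: contrapT].
    - by exists 0.
    - exact: openT.
    have [a Ca [b Cb abx]] : [set x - y | x in C & y in C] x by rewrite hgen.
    apply: (xP (Num.truncn (Num.max `|a| `|b|)).+1 I); apply: subset_closure.
    exists a, b; split => //; apply/ltW.
      by apply: le_lt_trans (truncnS_gt _); rewrite le_max lexx.
    by apply: le_lt_trans (truncnS_gt _); rewrite le_max lexx orbT.
  have /nbhs_ballP[r /= r0 rU] := open_nbhs_nbhs Ux0.
  exists n, x0, r; split => // y /rU Uy; apply: contrapT => ny.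
  by have : set0 y by rewrite -UE.
have closeE y d : 0 < d -> ball x0 r y -> exists2 z, E n z & `|y - z| < d.
  move=> d0 /ballE /(_ _ (nbhsx_ballx y d d0))[z [Ez]].
  by rewrite -ball_normE /= => yz; exists z.
(* Vectors of norm at most [2n], divided by the [t] below, have norm at most [4n|x|/r]; adding 1
   keeps the constant positive when [n = 0]. *)
exists (4 * n%:R / r + 1) => [|x e e0].
  by rewrite ltr_wpDl// divr_ge0 ?mulr_ge0// ltW.
have [->|x_neq0] := eqVneq x 0.
  by exists 0, 0; rewrite !subrr normr0 mulr0.
have xgt0 : 0 < `|x| by rewrite normr_gt0.
(* This puts [x0 + t *: x] at distance [r/2] from [x0]. Two approximation errors below [e * t / 2]
   add up to less than [e] after division by [t]. *)
pose t := r / (2 * `|x|).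
have t0 : 0 < t by rewrite divr_gt0// mulr_gt0.
have d0 : 0 < e * t / 2 by rewrite divr_gt0// mulr_gt0.
have [|_ [a1 [b1 [Ca1 Cb1 a1n b1n ->]]] near1] := closeE (x0 + t *: x) _ d0.
  rewrite -ball_normE /= opprD addNKr normrN normrZ gtr0_norm//.
  rewrite /t invfM mulrA divfK ?gt_eqF//.
  by rewrite ltr_pdivrMr// ltr_pMr// ltr1n.
have [|_ [a2 [b2 [Ca2 Cb2 a2n b2n ->]]] near2] := closeE x0 _ d0.
  exact: ballxx.
have bound (u v : X) : `|u| <= n%:R -> `|v| <= n%:R ->
    `|t^-1 *: (u + v)| <= (4 * n%:R / r + 1) * `|x|.
  move=> un vn; rewrite normrZ gtr0_norm ?invr_gt0//.
  apply: (@le_trans _ _ (t^-1 * (n%:R + n%:R))).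
    apply: ler_wpM2l; first by rewrite invr_ge0 ltW.
    by apply: le_trans (ler_normD _ _) _; exact: lerD.
  rewrite mulrDl mul1r ler_wpDr// /t invf_div le_eqVlt.
  by apply/orP; left; apply/eqP; ring.
have tV0 : 0 <= t^-1 by rewrite invr_ge0 ltW.
exists (t^-1 *: (a1 + b2)), (t^-1 *: (b1 + a2)); split.
- by apply: CZ => //; exact: CD.
- by apply: CZ => //; exact: CD.
- exact: bound.
- exact: bound.
have -> : x - (t^-1 *: (a1 + b2) - t^-1 *: (b1 + a2)) =
    t^-1 *: ((x0 + t *: x - (a1 - b1)) - (x0 - (a2 - b2))).
  have -> : x0 + t *: x - (a1 - b1) - (x0 - (a2 - b2)) =
      t *: x - (a1 + b2 - (b1 + a2)).
    have cancel (p q u v : X) : p + q - u - (p - v) = q - (u - v).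
      by rewrite !opprB [LHS]addrC -!addrA addKr addrCA.
    by rewrite cancel (opprD b1) addrACA -(opprB a2).
  by rewrite scalerBr scalerA mulVf ?gt_eqF// scale1r scalerBr.
rewrite normrZ gtr0_norm ?invr_gt0// ltr_pdivrMl//.
apply: le_lt_trans (ler_normB _ _) _.
by rewrite mulrC [ltRHS](splitr (e * t)) ltrD.
Qed.

(** Completeness turns absolute convergence into convergence, and closedness keeps the limit of the
    partial sums in the cone. *)
Lemma cone_series {u : X^nat} {M : R} :
  (forall n, C (u n)) -> (forall n, `|u n| <= M * 2^-1 ^+ n) ->
  exists a, [/\ C a, `|a| <= M * 2 & series u @ \oo --> a].
Proof.
move=> Cu uM; have [Ccl _ _ CD] := hC.
have M0 : 0 <= M.
  by have := le_trans (normr_ge0 _) (uM 0%N); rewrite expr0 mulr1.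
have half1 : `|2^-1 : R| < 1 by rewrite ger0_norm// invf_lt1// ltr1n.
have /normed_cvg ucv : cvgn [normed series u].
  apply: (@series_le_cvg _ _ (geometric M 2^-1)) => [n|n|n|].
  - exact: normr_ge0.
  - by rewrite /= mulr_ge0.
  - exact: uM.
  - exact: is_cvg_geometric_series.
exists (limn (series u)); split => //.
- apply: (closed_cvg C Ccl _ _ ucv); near=> n.
  by rewrite /series /=; elim/big_ind : _.
- apply: (cvgr_to_le (cvg_norm ucv)); near=> n => /=.
  apply: le_trans (ler_norm_sum _ _ _) _.
  apply: (@le_trans _ _ (series (geometric M 2^-1) n)).
    by apply: ler_sum => i _; exact: uM.
  have := @geometric_le_lim R n M 2^-1 M0 _ half1.
  suff -> : (1 - 2^-1 : R) = 2^-1 by rewrite invrK; apply; rewrite invr_gt0.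
  lra.
Unshelve. all: by end_near. Qed.

Lemma bounded_decomposition : generating C ->
  exists2 K : R, 0 < K & forall x : X, exists a b : X,
    [/\ C a, C b, `|a| <= K * `|x|, `|b| <= K * `|x| & x = a - b].
Proof.
move=> /approx_decomposition[K K0 approx].
(* Error [|y| / 2] halves the remainder at each step. The vector 0 is treated apart, as an allowed
   error must be positive. *)
have /choice[f fP] : forall y : X, exists p : X * X,
    [/\ C p.1, C p.2, `|p.1| <= K * `|y|, `|p.2| <= K * `|y| &
        `|y - (p.1 - p.2)| <= `|y| / 2].
  move=> y; have [->|y_neq0] := eqVneq y 0.
    by exists (0, 0); split; rewrite //= ?subrr normr0 ?mulr0 ?mul0r.
  have [|a [b [Ca Cb aK bK yab]]] := approx y (`|y| / 2).
    by rewrite divr_gt0// normr_gt0.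
  by exists (a, b); split => //; exact: ltW.
exists (K * 2) => [|x]; first by rewrite mulr_gt0.
(* [y n] is what is left of [x] after [n] corrections; the factor 2 in the constant is the sum of
   the powers of 1/2. *)
pose y n := iter n (fun z : X => z - ((f z).1 - (f z).2)) x.
have yx n : `|y n| <= `|x| * 2^-1 ^+ n.
  elim: n => [|n IHn]; first by rewrite expr0 mulr1.
  have [_ _ _ _ /le_trans] := fP (y n); apply.
  by rewrite exprSr mulrA ler_wpM2r ?invr_ge0.
have [|n|a [Ca aK cva]] := @cone_series (fun n => (f (y n)).1) (K * `|x|).
- by move=> n; case: (fP (y n)).
- case: (fP (y n)) => _ _ /le_trans + _ _; apply.
  by rewrite -mulrA ler_wpM2l// ltW.
have [|n|b [Cb bK cvb]] := @cone_series (fun n => (f (y n)).2) (K * `|x|).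
- by move=> n; case: (fP (y n)).
- case: (fP (y n)) => _ _ _ /le_trans + _; apply.
  by rewrite -mulrA ler_wpM2l// ltW.
rewrite mulrAC in aK; rewrite mulrAC in bK.
exists a, b; split => //.
(* The corrections telescope, so the difference of the two sums is [x] once [y n] tends to 0. *)
have partial n : series (fun n => (f (y n)).1) n -
    series (fun n => (f (y n)).2) n = x - y n.
  elim: n => [|n IHn]; first by rewrite /series /= !big_geq// !subrr.
  rewrite !seriesSr opprD addrACA [X in X + _]IHn.
  by rewrite [y n.+1]/= -/(y n) [in RHS]opprB -[LHS]addrA [- y n + _]addrC.
have y0 : y @ \oo --> 0.
  apply: norm_cvg0.
  apply: (@squeeze_cvgr _ _ _ _ (cst 0) (geometric `|x| 2^-1)).
  - by near=> n; rewrite /= normr_ge0 yx.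
  - exact: cvg_cst.
  - by apply: cvg_geometric; rewrite ger0_norm// invf_lt1// ltr1n.
have cvab : x - y n @[n --> \oo] --> a - b.
  by under eq_fun do rewrite -partial; exact: cvgB.
have cvx : x - y n @[n --> \oo] --> x.
  by rewrite -[X in _ --> X]subr0; apply: cvgB => //; exact: cvg_cst.
exact: cvg_unique cvx cvab.
Unshelve. all: by end_near. Qed.

End Cone.

(** * The two implications between bounded invertibility and small gain *)

Theorem proposition7p1 (R : realType) (X : completeNormedModType R)
  (C : set X) (hC : ordered_banach_cone C) (hgen : generating C)
  (A : {fun C >-> C}) :
  MBI C (fun x : X => x - A x) <-> uniform_small_gain C A.
Proof.
split.
- move=> [xi xiK hxi]; have [K K0 decomp] := bounded_decomposition hC hgen.
  have [h hK xih] := Kinfty_inverse xiK.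
  exists (fun t => h t / K); first exact: Kinfty_div.
  move=> x Cx; apply: le_dist => // p Cp.
  have [a [b [Ca Cb _ bK eab]]] := decomp (A x - x - p).
  rewrite ler_pdivrMr// mulrC; apply: le_trans bK.
  (* Applying [xi] to both sides replaces the goal [h |x| <= |b|] by [|x| <= xi |b|], an instance of
     MBI with [w := b]. *)
  rewrite -(Kinfty_le xiK) ?(Kinfty_ge0 hK) ?xih//.
  apply: hxi => //; rewrite /cone_le.
  have [_ _ _ CD] := hC.
  suff -> : b - (x - A x) = a + p by exact: CD.
  rewrite opprB -[A x](subrK x) -[A x - x](subrK p) eab.
  by rewrite addrK addrA [b + _]addrC subrK.
- move=> [eta etaK heta]; have [h hK etah] := Kinfty_inverse etaK.
  exists h => // v w Cv Cw; rewrite /cone_le => Cvw.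
  rewrite -(Kinfty_le etaK) ?(Kinfty_ge0 hK) ?etah//.
  apply: le_trans (heta v Cv) _; apply: le_trans (dist_le Cvw) _.
  by rewrite -(opprB v) -opprD normrN addrC subrK.
Qed.
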